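(* Let $\mathcal{C}\subset\mathbb{N}^p$ be an integer polyhedral cone and let $S\subset\mathcal{C}$ be an idemaxial semigroup, with associated linear functional $\ell$ and common numerical semigroup $T=S_1=\cdots=S_k$. Let $q_1,\dots,q_t$ be the pseudo-Frobenius numbers of $T$ and, for each $j$, let $\pi_j=\{\ell=q_j\}$ be the hyperplane containing the points $q_j u_i$, $1\le i\le k$. Then $$\bigcup_{j=1}^{t}(\pi_j\cap\mathcal{C})\subset PF(S).$$
   Context: $\mathbb{N}$ denotes the non-negative integers. An integer polyhedral cone $\mathcal{C}\subset\mathbb{N}^p$ is the set of points of $\mathbb{N}^p$ lying in the real cone $\{\sum_i\lambda_i v_i:\lambda_i\in\mathbb{R}_{\ge 0}\}$ generated by finitely many vectors $v_1,\dots,v_n\in\mathbb{N}^p$, not all zero. A $\mathcal{C}$-semigroup is a finitely generated additive submonoid $S$ (containing $0$) of $\mathcal{C}$ such that $\mathcal{H}(S)=\mathcal{C}\setminus S$ is finite. The set of pseudo-Frobenius numbers of $S$ is $PF(S)=\{a\in\mathcal{H}(S): a+(S\setminus\{0\})\subset S\}$. A numerical semigroup is a submonoid $T$ of $(\mathbb{N},+)$ with finite complement; its Frobenius number is the largest integer not in it, and its pseudo-Frobenius numbers are the integers $q\notin T$ with $q+(T\setminus\{0\})\subset T$. Let $\tau_1,\dots,\tau_k$ be the extremal rays of $\mathcal{C}$ and let $u_i\in\mathbb{N}^p$ be the primitive (coprime coordinates) integer vector generating $\tau_i$. For a $\mathcal{C}$-semigroup $S$, $S_i=\{n\in\mathbb{N}: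 n u_i\in S\}$ is a numerical semigroup, isomorphic to $S\cap\tau_i$ via $n\mapsto nu_i$. A $\mathcal{C}$-semigroup $S$ is idemaxial if: $S_1=\cdots=S_k=:T$; the points $u_1,\dots,u_k$ lie on a common hyperplane not through the origin, i.e. there is a linear functional $\ell$ on the real span of $\mathcal{C}$ with $\ell(u_i)=1$ for all $i$ (so that, for each $t$, the hyperplane containing the points $t u_i$, $1\le i\le k$, is $\{\ell=t\}$); and $$S=\{x\in\mathcal{C}:\ell(x)\in T\}\cup\{x\in\mathcal{C}:\ell(x)>F\},$$ where $F$ is the Frobenius number of $T$. In words: $S$ consists of the points of $\mathcal{C}$ lying on the hyperplanes through corresponding elements of the $S\cap\tau_i$, together with all points of $\mathcal{C}$ strictly beyond the hyperplane through the points $F u_i$. *)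

(* Defs.v *)
From HB Require Import structures.
From mathcomp Require Import all_boot all_order all_algebra.
From mathcomp Require Import boolp classical_sets cardinality reals.

Set Implicit Arguments.
Unset Strict Implicit.
Unset Printing Implicit Defensive.

Import Order.TTheory GRing.Theory Num.Theory.
Local Open Scope ring_scope.
Local Open Scope classical_set_scope.

Section Cones.
Variables (R : realType) (p : nat).

Definition realv (x : 'rV[nat]_p) : 'rV[R]_p := map_mx (fun m : nat => m%:R) x.

Definition real_cone (n : nat) (v : 'I_n -> 'rV[nat]_p) : set 'rV[R]_p :=
  [set x | exists lam : 'I_n -> R,
     (forall i, 0 <= lam i) /\ x = \sum_(i < n) lam i *: realv (v i)].

Definition int_cone (n : nat) (v : 'I_n -> 'rV[nat]_p) : set 'rV[nat]_p :=
  [set x | real_cone v (realv x)].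

Definition real_span (A : set 'rV[nat]_p) : set 'rV[R]_p :=
  [set x | exists (m : nat) (w : 'I_m -> 'rV[nat]_p) (c : 'I_m -> R),
     (forall i, A (w i)) /\ x = \sum_(i < m) c i *: realv (w i)].

(* A linear functional on a subspace V is encoded as a function on the whole
   space, whose values outside V are irrelevant. *)
Definition linear_functional_on (V : set 'rV[R]_p) (ell : 'rV[R]_p -> R) : Prop :=
  forall (a : R) (x y : 'rV[R]_p), V x -> V y ->
    ell (a *: x + y) = a * ell x + ell y.

Definition ray (d : 'rV[R]_p) : set 'rV[R]_p :=
  [set x | exists2 lam : R, 0 <= lam & x = lam *: d].

Definition extremal_ray (K tau : set 'rV[R]_p) : Prop :=
  [/\ exists2 d, d != 0 & tau = ray d,
      tau `<=` K &
      forall x y, K x -> K y -> tau (x + y) -> tau x /\ tau y].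

(* The gcd of the zero vector is 0, so primitive vectors are nonzero. *)
Definition primitive (u : 'rV[nat]_p) : Prop :=
  (\big[gcdn/0]_(j < p) u ord0 j)%N = 1%N.

(* tau lists the extremal rays of K without repetition, and u lists their
   primitive integer generators. *)
Record extremal_rays_of (K : set 'rV[R]_p) (k : nat)
    (tau : 'I_k -> set 'rV[R]_p) (u : 'I_k -> 'rV[nat]_p) : Prop := {
  extremal_rays_inj : injective tau;
  extremal_raysE : range tau = [set t | extremal_ray K t];
  extremal_rays_primitive : forall i, primitive (u i);
  extremal_rays_gen : forall i, tau i = ray (realv (u i))
}.

End Cones.

Arguments real_cone R {p n} v _.
Arguments real_span R {p} A _.

Section Semigroups.
Variable p : nat.
Implicit Types C S : set 'rV[nat]_p.

Definition finitely_generated S : Prop :=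
  exists (m : nat) (g : 'I_m -> 'rV[nat]_p),
    S = [set x | exists c : 'I_m -> nat, x = \sum_(i < m) g i *+ c i].

Record C_semigroup C S : Prop := {
  C_semigroup_sub : S `<=` C;
  C_semigroup0 : S 0;
  C_semigroupD : forall x y, S x -> S y -> S (x + y);
  C_semigroup_fg : finitely_generated S;
  C_semigroup_gaps : finite_set (C `\` S)
}.

Definition pseudo_Frobenius C S : set 'rV[nat]_p :=
  [set a | (C `\` S) a /\ forall s, S s -> s <> 0 -> S (a + s)].

Definition axis_semigroup S (u : 'rV[nat]_p) : set nat :=
  [set m | S (u *+ m)].

End Semigroups.

Section Numerical.
Variable T : set nat.

Definition int_of_numerical : set int := [set m%:Z | m in T].

(* Both notions range over all integers: for T = nat the Frobenius number and
   the only pseudo-Frobenius number are -1. *)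
Definition Frobenius_number (F : int) : Prop :=
  ~ int_of_numerical F /\ forall m, ~ int_of_numerical m -> m <= F.

Definition numerical_pseudo_Frobenius : set int :=
  [set q | ~ int_of_numerical q /\
     forall t, int_of_numerical t -> t <> 0 -> int_of_numerical (q + t)].

End Numerical.

Section Idemaxial.
Variables (R : realType) (p : nat).

Definition hyperplane (ell : 'rV[R]_p -> R) (c : R) : set 'rV[nat]_p :=
  [set x | ell (realv R x) = c].

Record idemaxial (C : set 'rV[nat]_p) (k : nat) (u : 'I_k -> 'rV[nat]_p)
    (S : set 'rV[nat]_p) (T : set nat) (ell : 'rV[R]_p -> R) : Prop := {
  idemaxial_semigroup : C_semigroup C S;
  idemaxial_axis : forall i, axis_semigroup S (u i) = T;
  idemaxial_linear : linear_functional_on (real_span R C) ell;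
  idemaxial_normal : forall i, ell (realv R (u i)) = 1;
  idemaxialE : exists2 F : int, Frobenius_number T F &
    S = [set x | C x /\ exists2 t : nat, T t & ell (realv R x) = t%:R] `|`
        [set x | C x /\ F%:~R < ell (realv R x)]
}.

End Idemaxial.

(* Main.v *)
(* A gap q of T, seen as ell a = q with a in the cone C, is at most F, so a is a
   gap of S.  For s in S \ {0}, ell s lies in T or exceeds F, so a + s is in S as
   soon as q >= 0 and ell s > 0.  Positivity of ell follows from the finiteness of
   C \ S: if x <> 0 in C had ell x < 0, all large multiples of x would be gaps,
   and if ell x = 0, all points a + n x would be gaps. *)
Require Import Defs.
From HB Require Import structures.
From mathcomp Require Import all_boot all_order all_algebra.
From mathcomp Require Import boolp classical_sets cardinality reals.

Set Implicit Arguments.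
Unset Strict Implicit.
Unset Printing Implicit Defensive.

Import Order.TTheory GRing.Theory Num.Theory.
Local Open Scope ring_scope.
Local Open Scope classical_set_scope.

Section ConeMonoid.
Variables (R : realType) (p : nat).
Implicit Types x y : 'rV[nat]_p.

Lemma realvD x y : realv R (x + y) = realv R x + realv R y.
Proof. by apply/matrixP => i j; rewrite !mxE natrD. Qed.

Lemma realv0 : realv R (0 : 'rV[nat]_p) = 0.
Proof. by apply/matrixP => i j; rewrite !mxE. Qed.

Lemma addmxI x : injective (+%R x).
Proof.
move=> y z /matrixP e; apply/matrixP => i j; move: (e i j).
by rewrite !mxE; apply: addnI.
Qed.

Lemma mulmxn_inj x : x != 0 -> injective (GRing.natmul x).
Proof.
move=> x0 m m' /matrixP e; have [i [j xij]] : exists i j, x i j != 0%N.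
  apply: contrapT => h; move/eqP: x0; apply; apply/matrixP => i j; rewrite mxE.
  by apply: contrapT => xij; apply: h; exists i, j; apply/eqP.
have xE l : (x *+ l) i j = (x i j * l)%N.
  by elim: l => [|l IHl]; rewrite ?muln0 ?mulr0n ?mxE // mulrS mxE IHl mulnS.
move: (e i j); rewrite !xE => /eqP; rewrite eqn_pmul2l ?lt0n //.
by move/eqP.
Qed.

(** For [x != 0] the map [m => y + x *+ (N + m)] is injective, by cancellation in each entry, so a
    finite [A] would have a finite preimage, yet that preimage is all of [nat]. Applied below to the
    set of gaps. *)
Lemma finite_set_progression (A : set 'rV[nat]_p) y x (N : nat) :
  finite_set A -> x != 0 -> (forall m, (N <= m)%N -> A (y + x *+ m)) -> False.
Proof.
move=> finA x0 h; apply: infinite_nat.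
have : finite_set ((fun m : nat => y + x *+ (N + m)) @^-1` A).
  apply: finite_preimage => // m m' _ _ /= /addmxI /(mulmxn_inj x0).
  exact: addnI.
by apply: sub_finite_set => m _ /=; apply: h; rewrite leq_addr.
Qed.

Variables (n : nat) (v : 'I_n -> 'rV[nat]_p).

Lemma int_cone0 : int_cone R v 0.
Proof.
exists (fun=> 0); split=> //; rewrite realv0 big1 // => i _.
by rewrite scale0r.
Qed.

Lemma int_coneD x y : int_cone R v x -> int_cone R v y -> int_cone R v (x + y).
Proof.
move=> [a [a0 xE]] [b [b0 yE]]; exists (fun i => a i + b i); split.
  by move=> i; rewrite addr_ge0.
rewrite realvD xE yE -big_split /=; apply: eq_bigr => i _.
by rewrite scalerDl.
Qed.

Lemma int_coneMn x m : int_cone R v x -> int_cone R v (x *+ m).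
Proof.
move=> Cx; elim: m => [|m IHm]; first exact: int_cone0.
by rewrite mulrS; apply: int_coneD.
Qed.

End ConeMonoid.

Lemma sub_real_span (R : realType) (p : nat) (A : set 'rV[nat]_p) x :
  A x -> real_span R A (realv R x).
Proof.
move=> Ax; exists 1%N, (fun=> x), (fun=> 1); split=> //.
by rewrite big_ord1 scale1r.
Qed.

(** The integer -1 is never a natural number, so maximality of [F] applies to it; equality occurs
    for [T] all of [nat]. *)
Lemma Frobenius_number_ge (T : set nat) (F : int) :
  Frobenius_number T F -> -1 <= F.
Proof. by case=> _; apply => -[]. Qed.

Section Idemaxial.
Variables (R : realType) (p n : nat) (v : 'I_n -> 'rV[nat]_p) (k : nat).
Variables (u : 'I_k -> 'rV[nat]_p) (S : set 'rV[nat]_p) (T : set nat).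
Variable ell : 'rV[R]_p -> R.
Hypothesis hS : idemaxial (int_cone R v) u S T ell.
Let C := int_cone R v.
Let f x := ell (realv R x).

Lemma idemaxial_additive x y : C x -> C y -> f (x + y) = f x + f y.
Proof.
move=> Cx Cy; rewrite /f realvD -[realv R x in LHS]scale1r.
by rewrite (idemaxial_linear hS) ?mul1r //; apply: sub_real_span.
Qed.

Lemma idemaxial_progression x y m :
  C x -> C y -> f (y + x *+ m) = f y + f x *+ m.
Proof.
move=> Cx Cy; elim: m => [|m IHm]; first by rewrite !mulr0n !addr0.
rewrite !mulrSr !addrA idemaxial_additive ?IHm //.
by apply: int_coneD => //; apply: int_coneMn.
Qed.

(** On [S] the value of [ell] is a natural number or exceeds [F >= -1]; the threshold -1 serves both
    cases. *)
Lemma idemaxial_gap_lt x : C x -> f x < -1 -> (C `\` S) x.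
Proof.
move=> Cx fx1; split=> //.
have [F /Frobenius_number_ge F1 ->] := idemaxialE hS.
case=> -[_]; rewrite -/(f x).
  case=> t _ fxE; move: fx1; rewrite fxE ltNge (le_trans _ (ler0n _ _)) //.
  by rewrite oppr_le0.
apply/negP; rewrite -leNgt (le_trans (ltW fx1)) //.
by rewrite -[leLHS](intrN R 1) ler_int.
Qed.

(** Maximality of [F] gives [q <= F], which rules out the upper part of [S]; injectivity of the
    embedding of [int] in [R] rules out the levels of [T]. *)
Lemma idemaxial_gap x (q : int) :
  C x -> ~ int_of_numerical T q -> f x = q%:~R -> (C `\` S) x.
Proof.
move=> Cx qT fx; split=> //.
have [F [_ Fmax] ->] := idemaxialE hS.
case=> -[_]; rewrite -/(f x) fx.
  by case=> t Tt /(@intr_inj R q t) qt; apply: qT; exists t.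
by rewrite ltr_int ltNge Fmax.
Qed.

Lemma idemaxial_ge0 x : C x -> 0 <= f x.
Proof.
move=> Cx; rewrite leNgt; apply/negP => fx_lt0.
have x_neq0 : x != 0.
  (* Additivity at 0 reads [f 0 = f 0 + f 0], hence [f 0 = 0]. *)
  apply/eqP => x0; move: (idemaxial_additive Cx Cx) fx_lt0.
  by rewrite x0 addr0 -[LHS]addr0 => /addrI <-; rewrite ltxx.
(* Any [m >= N] exceeds [1 / (- f x)], so [f x *+ m] is below -1. *)
pose N := Num.bound (- f x)^-1.
apply: (finite_set_progression (C_semigroup_gaps (idemaxial_semigroup hS))
  x_neq0 (y := x) (N := N)) => m Nm.
apply: idemaxial_gap_lt; first by apply: int_coneD => //; apply: int_coneMn.
have Nfx : 1 < - f x *+ m.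
  rewrite -mulr_natr -ltr_pdivrMl ?oppr_gt0 // mulr1.
  apply: (lt_le_trans (archi_boundP _)); last by rewrite ler_nat.
  by rewrite invr_ge0 oppr_ge0 ltW.
rewrite idemaxial_progression // -[ltRHS]add0r ltrD //.
by rewrite ltrNr -mulNrn.
Qed.

(** The point [a] serves as base: a direction with [f x = 0] would never leave its level [q], where
    every point of the cone is a gap. *)
Lemma idemaxial_gt0 x a (q : int) : C a -> ~ int_of_numerical T q ->
  f a = q%:~R -> C x -> x != 0 -> 0 < f x.
Proof.
move=> Ca qT fa Cx x0; rewrite lt_def idemaxial_ge0 // andbT; apply/eqP => fx0.
apply: (finite_set_progression (C_semigroup_gaps (idemaxial_semigroup hS))
  x0 (y := a) (N := 0)) => m _.
apply: (@idemaxial_gap _ q) => //.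
  by apply: int_coneD => //; apply: int_coneMn.
by rewrite idemaxial_progression // fx0 mul0rn addr0.
Qed.

End Idemaxial.

Theorem proposition6 (R : realType) (p n : nat) (v : 'I_n -> 'rV[nat]_p)
    (hv : exists i, v i != 0)
    (k : nat) (tau : 'I_k -> set 'rV[R]_p) (u : 'I_k -> 'rV[nat]_p)
    (hu : extremal_rays_of (real_cone R v) tau u)
    (S : set 'rV[nat]_p) (T : set nat) (ell : 'rV[R]_p -> R)
    (hS : idemaxial (int_cone R v) u S T ell) :
  \bigcup_(q in numerical_pseudo_Frobenius T)
      (hyperplane ell q%:~R `&` int_cone R v)
    `<=` pseudo_Frobenius (int_cone R v) S.
Proof.
move=> a [q [qT qPF] [/= faq Ca]]; split; first exact: (idemaxial_gap hS Ca qT).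
move=> s Ss /eqP s0.
have Cs := C_semigroup_sub (idemaxial_semigroup hS) Ss.
have fs_gt0 := idemaxial_gt0 hS Ca qT faq Cs s0.
(* This is [0 <= ell a], where [ell a] is [q]; it excludes the pseudo-Frobenius number -1 of
   [nat]. *)
have q_ge0 := idemaxial_ge0 hS Ca.
have fas := idemaxial_additive hS Ca Cs.
have Cas := int_coneD Ca Cs.
have [F FT SE] := idemaxialE hS; move: Ss; rewrite SE.
(* If [s] lies beyond level [F], adding the nonnegative [ell a] keeps it there. *)
case=> -[_]; last by move=> Fs; right; split; rewrite // fas ltr_wpDl.
move=> [t Tt fst]; left; split=> //.
(* If [s] lies on a level [t] of [T], then [0 < ell s] forces [t <> 0], so [q + t] is again in [T]
   and is the level of [a + s]. *)
have [||t' Tt' t'E] := qPF t; first by exists t.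
  by case=> t0; move: fs_gt0; rewrite fst t0 ltxx.
by exists t' => //; rewrite fas faq fst -[t'%:R]/((t' : int)%:~R) t'E intrD.
Qed.
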